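(* Consider the combined system $(M,b)$ of $n+1$ consistent linear systems with solutions $x_*^{(0)},\dots,x_*^{(n)}$, satisfying the Uniqueness Assumption, and let $(x_k^{(0)},\dots,x_k^{(n)})_{k\ge 0}$ be the iterates of the MRK algorithm (all as defined in the context) with swap probability $r$ and sampling distribution $\mathcal{D}$. Define $$e_k=\sum_{i=0}^n \left\|x_k^{(i)}-x_*^{(i)}\right\|^2 .$$ If $r\ge 0$ is sufficiently small (that is, there is $r_0>0$ such that the following holds for every $r\in[0,r_0]$), then there is a constant $C_0<1$, depending on $M$, $b$, $n$ and $r$, such that for every $c\in(C_0,1)$ and every $\delta>0$ there exists $\varepsilon>0$ with the following property: for every $k$, if $e_k<\varepsilon$, then there is an event $A_\delta$ of probability at least $1-\delta$ such that, for all $h\in\mathbb{N}$, $$\mathbb{E}\left(e_{k+h}\mid A_\delta\right)\le c^{h}\, e_k .$$ Here probabilities and expectations are taken over the randomness of the algorithm from step $k$ onward, with the iterates at step $k$ given.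
   Context: Problem setting. Let $n\in\mathbb{N}$ and $d\ge 1$. For $i\in\{0,1,\dots,n\}$ let $M^{(i)}x_*^{(i)}=b^{(i)}$ be a consistent real linear system in $d$ unknowns with solution $x_*^{(i)}\in\mathbb{R}^d$. Let $M\in\mathbb{R}^{m\times d}$ be the matrix and $b\in\mathbb{R}^m$ the vector obtained by stacking all $M^{(i)}$ and all $b^{(i)}$ respectively (rows possibly shuffled, in the same way for $M$ and $b$). The $\ell$-th row of $M$ is denoted $M_\ell$ (a nonzero row vector) and the corresponding entry of $b$ is $b_\ell$. $\|\cdot\|$ is the Euclidean norm. Uniqueness Assumption. The solution to the set of systems is unique up to relabeling: if $x_0,\dots,x_n\in\mathbb{R}^d$ are such that for every row index $\ell\in\{1,\dots,m\}$ there is an index $i_\ell\in\{0,\dots,n\}$ with $M_\ell x_{i_\ell}=b_\ell$, then there is a permutation $\sigma$ of $\{0,1,\dots,n\}$ with $x_*^{(i)}=x_{\sigma(i)}$ for all $i$. Multi-Randomized Kaczmarz (MRK) algorithm with swap probability $r\in[0,1]$ and sampling distribution $\mathcal{D}$, a probability distribution on the row indices $\{1,\dots,m\}$ given as input. Start from initial iterates $x_0^{(0)},\dots,x_0^{(n)}\in\mathbb{R}^d$. For $k=0,1,2,\dots$: (1) sample a row index $i_k\sim\mathcal{D}$, independently of the past; (2) compute $c_{i,k}=\dfrac{M_{i_k}x_k^{(i)}-b_{i_k}}{\|M_{i_k}\|^2}$ for $i=0,\dots,n$; (3) let $s_k\in\operatorname{argmin}_{i\in\{0,\dots,n\}}|c_{i,k}|$;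 (4) with probability $1-r$ set $t_k=s_k$, and with the remaining probability $r$ let $t_k$ be uniformly distributed on $\{0,\dots,n\}$ (so each $t\in\{0,\dots,n\}$ is selected in this way with probability $\frac{r}{n+1}$), using fresh independent randomness; (5) set $x_{k+1}^{(t_k)}=x_k^{(t_k)}-|c_{s_k,k}|\operatorname{sgn}(c_{t_k,k})\,M_{i_k}^T$ and $x_{k+1}^{(j)}=x_k^{(j)}$ for $j\ne t_k$.
   Formalization: The sampling distribution D is assumed to give every row positive probability (otherwise false: n=0, M the 2x2 identity, D a point mass on one row), and r_0 and C_0 may depend on D as well as on M, b, n, r. *)

(* Defs.v *)
From HB Require Import structures.
From mathcomp Require Export all_boot all_order all_algebra all_fingroup.
From mathcomp Require Export all_classical all_reals all_analysis.

Set Implicit Arguments.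
Unset Strict Implicit.
Unset Printing Implicit Defensive.

Import Order.TTheory GRing.Theory Num.Theory.
Local Open Scope classical_set_scope.
Local Open Scope ring_scope.

(* The library norm `|v| on matrices is the sup norm. *)
Definition enorm (R : realType) (d : nat) (v : 'cV[R]_d) : R :=
  Num.sqrt (\sum_(i < d) v i 0 ^+ 2).

Definition is_distribution (R : realType) (m : nat) (D : 'I_m -> R) : Prop :=
  (forall l, 0 <= D l) /\ \sum_(l < m) D l = 1.

Section MRK.
Variables (R : realType) (m d n : nat).
Implicit Types (M : 'M[R]_(m, d)) (b : 'cV[R]_m).
Implicit Types (x y : 'I_n.+1 -> 'cV[R]_d).

Definition unique_solutions M b (xs : 'I_n.+1 -> 'cV[R]_d) : Prop :=
  forall y,
    (forall l : 'I_m, exists i : 'I_n.+1, (M *m y i) l 0 = b l 0) ->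
    exists sg : 'S_n.+1, forall i, xs i = y (sg i).

Definition mrk_coef M b x (l : 'I_m) (i : 'I_n.+1) : R :=
  ((M *m x i) l 0 - b l 0) / enorm (row l M)^T ^+ 2.

Definition is_argmin M b x (l : 'I_m) (s : 'I_n.+1) : Prop :=
  forall i, `|mrk_coef M b x l s| <= `|mrk_coef M b x l i|.

Definition mrk_step M b x (l : 'I_m) (s t : 'I_n.+1) : 'I_n.+1 -> 'cV[R]_d :=
  fun i =>
    if i == t then
      x t - (`|mrk_coef M b x l s| * Num.sg (mrk_coef M b x l t)) *: (row l M)^T
    else x i.

Definition sq_error (xs x : 'I_n.+1 -> 'cV[R]_d) : R :=
  \sum_(i < n.+1) enorm (x i - xs i) ^+ 2.

End MRK.

Section Probability.
Context (disp : measure_display) (T : measurableType disp) (R : realType).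
Variable P : probability T R.

Definition sigma_of (F : finType) (Z : nat -> T -> F) (J : set nat) :
    set (set T) :=
  <<s [set B | exists j z, J j /\ B = [set w | Z j w = z]] >>.

(* Conditioning on an event B; only meaningful when 0 < P B. *)
Definition cond_prob (A B : set T) : \bar R := (P (A `&` B) / P B)%E.

Definition cond_expect (Y : T -> R) (B : set T) : \bar R :=
  ((\int[P]_(w in B) (Y w)%:E) / P B)%E.

End Probability.

Section Run.
Context (disp : measure_display) (T : measurableType disp) (R : realType).
Variables (P : probability T R) (m d n : nat).

(* Step k uses the sampled row I k, the minimizing index S k, the coin W k
   (true means that the updated index is drawn at random) and the uniform index
   U k. *)
Definition mrk_draws (I : nat -> T -> 'I_m) (S : nat -> T -> 'I_n.+1)
    (W : nat -> T -> bool) (U : nat -> T -> 'I_n.+1) :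
    nat -> T -> 'I_m * 'I_n.+1 * bool * 'I_n.+1 :=
  fun k w => (I k w, S k w, W k w, U k w).

(* Ties in the argmin may be broken by any rule, possibly randomized and
   depending on the past and on the sampled row.  Hence independence is
   stated step by step: the row I k is independent of all draws before step k,
   and (W k, U k) is independent of these draws together with I k and S k. *)
Record mrk_run (M : 'M[R]_(m, d)) (b : 'cV[R]_m) (D : 'I_m -> R) (r : R)
    (x0 : 'I_n.+1 -> 'cV[R]_d)
    (I : nat -> T -> 'I_m) (S : nat -> T -> 'I_n.+1)
    (W : nat -> T -> bool) (U : nat -> T -> 'I_n.+1)
    (X : nat -> T -> 'I_n.+1 -> 'cV[R]_d) : Prop := MrkRun {
  mrk_measurable : forall k z, measurable [set w | mrk_draws I S W U k w = z];
  mrk_init : forall w, X 0%N w = x0;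
  mrk_argmin : forall k w, is_argmin M b (X k w) (I k w) (S k w);
  mrk_update : forall k w,
    X k.+1 w =
      mrk_step M b (X k w) (I k w) (S k w) (if W k w then U k w else S k w);
  mrk_row_law : forall k H l,
    sigma_of (mrk_draws I S W U) [set j | (j < k)%N] H ->
    P (H `&` [set w | I k w = l]) = (P H * (D l)%:E)%E;
  mrk_swap_law : forall k H l s (v : bool) u,
    sigma_of (mrk_draws I S W U) [set j | (j < k)%N] H ->
    P (H `&` [set w | I k w = l /\ S k w = s] `&`
         [set w | W k w = v /\ U k w = u]) =
    (P (H `&` [set w | I k w = l /\ S k w = s]) *
       ((if v then r else 1 - r) / n.+1%:R)%:E)%E
}.

End Run.

(* Main.v *)
(* Close to the solutions, the argmin index always solves the sampled row, by a
   gap between the residuals of the solving and the non-solving systems.  Then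
   a regular step projects the argmin iterate onto the hyperplane of the row and
   decreases the error, and any other step multiplies the error by at most 4.
   By the Uniqueness Assumption the rows solved by the j-th system only span
   the whole space, hence the average decrease is at least a fixed fraction of
   the error, and for small r the error is contracted in expectation as long as
   it stays below a threshold e1.  A maximal inequality bounds the probability
   of ever exceeding e1 by e_k / e1, and A is the event that this never happens.
   Conditioning on A costs the factor 1 / (1 - rho), which is absorbed by
   passing from C0 to c; for h = 0 the bound holds with no loss. *)
Require Import Defs.
From mathcomp Require Import measurable_realfun ring lra.
Set Implicit Arguments.
Unset Strict Implicit.
Unset Printing Implicit Defensive.
Import Order.TTheory GRing.Theory Num.Theory.
Local Open Scope classical_set_scope.
Local Open Scope ring_scope.

(** * Chains driven by finite-valued draws *)

Section SigmaOf.
Context (disp : measure_display) (T : measurableType disp) (F : finType).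
Variable Z : nat -> T -> F.

Lemma sigma_of_bigcap (J : set nat) (G : nat -> set T) :
  (forall i, sigma_of Z J (G i)) -> sigma_of Z J (\bigcap_i G i).
Proof.
move=> mG; pose E := [set B | exists j z, J j /\ B = [set w | Z j w = z]].
exact: (@bigcapT_measurable _ (g_sigma_algebraType E)).
Qed.

Lemma sigma_of_setI (J : set nat) A B :
  sigma_of Z J A -> sigma_of Z J B -> sigma_of Z J (A `&` B).
Proof.
move=> mA mB; pose E := [set B | exists j z, J j /\ B = [set w | Z j w = z]].
exact: (@measurableI _ (g_sigma_algebraType E)).
Qed.

Lemma sigma_of_setT (J : set nat) : sigma_of Z J setT.
Proof.
pose E := [set B | exists j z, J j /\ B = [set w | Z j w = z]].
exact: (@measurableT _ (g_sigma_algebraType E)).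
Qed.

Lemma sigma_of_set0 (J : set nat) : sigma_of Z J set0.
Proof.
pose E := [set B | exists j z, J j /\ B = [set w | Z j w = z]].
exact: (@measurable0 _ (g_sigma_algebraType E)).
Qed.

Lemma sigma_of_bigsetU (J : set nat) (G : F -> set T) :
  (forall z, sigma_of Z J (G z)) ->
  sigma_of Z J (\big[setU/set0]_(z : F) G z).
Proof.
move=> mG; pose E := [set B | exists j z, J j /\ B = [set w | Z j w = z]].
by apply: (@bigsetU_measurable _ (g_sigma_algebraType E)) => *; exact: mG.
Qed.

Lemma sigma_of_draw (J : set nat) j (Q : set F) :
  J j -> sigma_of Z J [set w | Q (Z j w)].
Proof.
move=> Jj; rewrite (_ : [set w | _] =
    \big[setU/set0]_(z : F) ([set w | Z j w = z] `&` [set w | Q z])).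
  apply: sigma_of_bigsetU => z; apply: sigma_of_setI.
    by apply: sub_sigma_algebra; exists j, z.
  have [Qz|Qz] := pselect (Q z).
    rewrite (_ : [set w | _] = setT); first exact: sigma_of_setT.
    by apply/seteqP; split.
  rewrite (_ : [set w | _] = set0); first exact: sigma_of_set0.
  by apply/seteqP; split.
rewrite -bigcup_seq; apply/seteqP; split => w /=.
  by move=> Qw; exists (Z j w) => //=; rewrite mem_index_enum.
by move=> [z _ /= [<-]].
Qed.

Lemma sigma_of_sub (J J' : set nat) A :
  J `<=` J' -> sigma_of Z J A -> sigma_of Z J' A.
Proof.
move=> JJ'; apply: sub_sigma_algebra2 => B [j [z [Jj ->]]].
by exists j, z; split => //; exact: JJ'.
Qed.

Lemma sigma_of_measurable (J : set nat) A :
  (forall j z, measurable [set w | Z j w = z]) ->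
  sigma_of Z J A -> measurable A.
Proof.
move=> mZ; apply: smallest_sub; first exact: sigma_algebra_measurable.
by move=> B [j [z [_ ->]]]; exact: mZ.
Qed.

(** A chain restarted at the constant [y0] at time [k] sees only the draws from [k] to [k + h - 1].
    As [F] is finite, its state at each [h] takes finitely many values, so every subset [Q] is
    allowed and [V] carries no sigma-algebra. *)
Lemma sigma_of_orbit (V : Type) (f : V -> F -> V) (Y : nat -> T -> V) (y0 : V)
    (k : nat) (J : set nat) :
  (forall w, Y 0%N w = y0) ->
  (forall h w, Y h.+1 w = f (Y h w) (Z (k + h)%N w)) ->
  forall h (Q : set V), (forall j, (k <= j < k + h)%N -> J j) ->
  sigma_of Z J [set w | Q (Y h w)].
Proof.
move=> Y0 YS; elim=> [|h IH] Q hJ.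
  have [Qy|Qy] := pselect (Q y0).
    rewrite (_ : [set w | _] = setT); first exact: sigma_of_setT.
    by apply/seteqP; split => w //= _; rewrite Y0.
  rewrite (_ : [set w | _] = set0); first exact: sigma_of_set0.
  by apply/seteqP; split => w //=; rewrite Y0.
rewrite (_ : [set w | _] = \big[setU/set0]_(z : F)
    ([set w | Z (k + h)%N w = z] `&` [set w | Q (f (Y h w) z)])).
  apply: sigma_of_bigsetU => z; apply: sigma_of_setI.
    by apply: (sigma_of_draw (fun z' => z' = z)); apply: hJ; rewrite leq_addr addnS ltnSn.
  apply: (IH (fun y => Q (f y z))) => j /andP[kj jh]; apply: hJ.
  by rewrite kj addnS ltnS ltnW.
rewrite -bigcup_seq; apply/seteqP; split => w /=.
  by rewrite YS => Qw; exists (Z (k + h)%N w) => //=; rewrite mem_index_enum.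
by move=> [z _ /= [<- ]]; rewrite YS.
Qed.

End SigmaOf.

Section FinitePartition.
Context (disp : measure_display) (T : measurableType disp) (R : realType).
Variables (P : probability T R) (F : finType) (g : T -> F).
Hypothesis mg : forall z, measurable [set w | g w = z].

Lemma ge0_integral_partition H (h : T -> \bar R) : measurable H ->
  measurable_fun H h -> (forall w, (0 <= h w)%E) ->
  (\int[P]_(w in H) h w =
   \sum_(z : F) \int[P]_(w in H `&` [set w | g w = z]) h w)%E.
Proof.
move=> mH mh h0.
have HE : H = \big[setU/set0]_(z : F) (H `&` [set w | g w = z]).
  rewrite -bigcup_seq; apply/seteqP; split => w /=.
    by move=> Hw; exists (g w) => //=; rewrite mem_index_enum.
  by move=> [z _ /= []].
rewrite {1}HE ge0_integral_bigsetU//.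
- by move=> z; apply: measurableI => //; exact: mg.
- exact: index_enum_uniq.
- by move=> z z' _ _ [w /= [[_ <-] [_ <-]]].
- by rewrite -HE.
Qed.

Lemma probability_partition H : measurable H ->
  (P H = \sum_(z : F) P (H `&` [set w | g w = z]))%E.
Proof.
move=> mH; rewrite -[LHS]mul1e -integral_cst//= ge0_integral_partition//.
apply: eq_bigr => z _; rewrite integral_cst ?mul1e//.
by apply: measurableI => //; exact: mg.
Qed.

End FinitePartition.

(** * Chains whose error contracts in mean below a threshold *)

Section Chain.
Context (disp : measure_display) (T : measurableType disp) (R : realType).
Variables (P : probability T R) (F : finType) (V : Type).
Variables (Z : nat -> T -> F) (f : V -> F -> V) (X : nat -> T -> V) (x0 : V).
Variables (err : V -> R) (C e1 : R).
Hypothesis mZ : forall j z, measurable [set w | Z j w = z].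
Hypothesis X0 : forall w, X 0%N w = x0.
Hypothesis XS : forall j w, X j.+1 w = f (X j w) (Z j w).
Hypothesis err_ge0 : forall y, 0 <= err y.
Hypotheses (C_ge0 : 0 <= C) (C_le1 : C <= 1) (e1_gt0 : 0 < e1).

Let past N : set (set T) := sigma_of Z [set j | (j < N)%N].
Let pr (H : set T) : R := fine (P H).

(** The drift condition in integrated form: the sum over the atoms of the next draw is the
    conditional mean of the next error given [H], multiplied by [pr H]. *)
Hypothesis contraction : forall N y H, past N H -> H `<=` [set w | X N w = y] ->
  err y < e1 ->
  \sum_z err (f y z) * pr (H `&` [set w | Z N w = z]) <= C * err y * pr H.

Lemma past_state N (Q : set V) : past N [set w | Q (X N w)].
Proof. by apply: (sigma_of_orbit (k := 0) X0). Qed.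

Lemma past_measurable N H : past N H -> measurable H.
Proof. exact: sigma_of_measurable. Qed.

Lemma past_draw N H z : past N H -> past N.+1 (H `&` [set w | Z N w = z]).
Proof.
move=> pH; apply: sigma_of_setI; last by apply: (sigma_of_draw (fun z' => z' = z)) => /=.
by apply: sigma_of_sub pH => j /=; exact: ltnW.
Qed.

Lemma measurable_state N (Q : set V) : measurable [set w | Q (X N w)].
Proof. apply: past_measurable; exact: past_state. Qed.

Lemma measurable_err N D : measurable_fun D (EFin \o (fun w => err (X N w))).
Proof.
apply/measurable_EFinP => mD B mB; apply: measurableI => //.
exact: (measurable_state N (err @^-1` B)).
Qed.

Lemma prE H : measurable H -> P H = (pr H)%:E.
Proof. by move=> mH; rewrite /pr fineK// fin_num_measure. Qed.

Lemma pr_ge0 H : 0 <= pr H.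
Proof. exact: fine_ge0. Qed.

Let stay N h := [set w | forall i, (i <= h)%N -> err (X (N + i)%N w) < e1].

(** Peeling off the first time serves the inductions below, which advance the starting time [N] and
    keep the final time fixed. *)
Lemma staySE N h : stay N h.+1 = [set w | err (X N w) < e1] `&` stay N.+1 h.
Proof.
apply/seteqP; split => w.
  move=> st; split => [|i ih]; first by have /= := st 0%N; rewrite addn0; apply.
  by rewrite addSnnS; exact: st.
by move=> [s0 st] [|i] ih; rewrite ?addn0// -addSnnS; exact: st.
Qed.

Lemma stay0E N : stay N 0 = [set w | err (X N w) < e1].
Proof.
apply/seteqP; split => w /=.
  by move=> /(_ 0%N); rewrite addn0; apply.
by move=> s0 [|i] //; rewrite addn0.
Qed.

Lemma measurable_stay N h : measurable (stay N h).
Proof.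
elim: h N => [|h IH] N.
  by rewrite stay0E; exact: (measurable_state N (fun y => err y < e1)).
rewrite staySE; apply: measurableI => //.
exact: (measurable_state N (fun y => err y < e1)).
Qed.

Lemma draw_state N y H z : H `<=` [set w | X N w = y] ->
  H `&` [set w | Z N w = z] `<=` [set w | X N.+1 w = f y z].
Proof. by move=> Hy w /= [/Hy/= Xy Zz]; rewrite XS Xy Zz. Qed.

(* The induction goes forward in time, splitting H along the next draw, so that
   the one-step hypothesis is only ever used on events of fixed current state. *)
Lemma expect_stay h N y H : past N H -> H `<=` [set w | X N w = y] ->
  err y < e1 ->
  (\int[P]_(w in H `&` stay N h) (err (X (N + h)%N w))%:E
    <= (C ^+ h * err y * pr H)%:E)%E.
Proof.
elim: h N y H => [|h IH] N y H pH Hy ye1.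
  have mH := past_measurable pH.
  rewrite addn0 expr0 mul1r EFinM -prE// -integral_cst//=.
  have -> : H `&` stay N 0 = H.
    rewrite stay0E; apply/seteqP; split => [w []//|w Hw]; split => //=.
    by rewrite (Hy _ Hw).
  rewrite le_eqVlt; apply/orP; left; apply/eqP; apply: eq_integral => w.
  by rewrite inE => /Hy /= ->.
have mH := past_measurable pH.
rewrite (ge0_integral_partition P (mZ N)); last 3 first.
- by apply: measurableI => //; exact: measurable_stay.
- exact: measurable_err.
- by move=> w; rewrite lee_fin.
apply: (@le_trans _ _ (\sum_(z : F)
    (C ^+ h * err (f y z) * pr (H `&` [set w | Z N w = z]))%:E)%E).
  apply: lee_sum => z _.
  have Hz := draw_state (z := z) Hy.
  have -> : H `&` stay N h.+1 `&` [set w | Z N w = z] =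
            H `&` [set w | Z N w = z] `&` stay N.+1 h.
    rewrite staySE; apply/seteqP; split => w /=; first by move=> [[? [_ ?]] ?].
    by move=> [[Hw zw] sw]; rewrite (Hy _ Hw).
  (* A next state at or above [e1] is incompatible with staying, so such an atom contributes
     zero. *)
  have [fe1|fe1] := ltP (err (f y z)) e1.
    by rewrite addnS -addSn; apply: IH => //; exact: past_draw.
  rewrite (_ : _ `&` stay _ _ = set0) ?integral_set0 ?lee_fin.
    by rewrite !mulr_ge0 ?pr_ge0 ?exprn_ge0.
  apply/seteqP; split => // w [/Hz /= Xw] /(_ 0%N (leq0n _)).
  by rewrite addn0 Xw ltNge fe1.
rewrite sumEFin lee_fin.
under eq_bigr do rewrite -mulrA.
rewrite -mulr_sumr exprSr -!mulrA ler_wpM2l ?exprn_ge0// mulrA.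
exact: contraction.
Qed.

(** The maximal inequality for a nonnegative supermartingale, by conditioning on the next draw;
    [C <= 1] lets the bound propagate. It is uniform in [h], hence survives the limit in
    [local_contraction]. *)
Lemma prob_exit h N y H : past N H -> H `<=` [set w | X N w = y] ->
  err y < e1 -> pr (H `\` stay N h) <= err y / e1 * pr H.
Proof.
elim: h N y H => [|h IH] N y H pH Hy ye1.
  rewrite (_ : _ `\` _ = set0) ?/pr ?measure0/= ?mulr_ge0 ?pr_ge0 ?invr_ge0//.
    exact: ltW.
  by rewrite stay0E; apply/seteqP; split => // w [Hw]; apply=> /=; rewrite (Hy _ Hw).
have mH := past_measurable pH.
have mD : measurable (H `\` stay N h.+1).
  by apply: measurableD => //; exact: measurable_stay.
rewrite -lee_fin -prE// (probability_partition P (mZ N))//.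
apply: (@le_trans _ _ (\sum_(z : F)
    (err (f y z) / e1 * pr (H `&` [set w | Z N w = z]))%:E)%E).
  apply: lee_sum => z _.
  have Hz := draw_state (z := z) Hy.
  have mHz : measurable (H `&` [set w | Z N w = z]).
    exact: (past_measurable (past_draw z pH)).
  have DE : (H `\` stay N h.+1) `&` [set w | Z N w = z] =
            H `&` [set w | Z N w = z] `\` stay N.+1 h.
    rewrite staySE; apply/seteqP; split => w /=.
      move=> [[Hw nw] zw]; split => // sw; apply: nw; split => //=.
      by rewrite (Hy _ Hw).
    by move=> [[Hw zw] nw]; split => //; split => // -[].
  have mDz : measurable (H `&` [set w | Z N w = z] `\` stay N.+1 h).
    by apply: measurableD => //; exact: measurable_stay.
  rewrite DE prE// lee_fin.
  (* Once the threshold is reached, [err / e1] is at least 1 and the trivial bound on the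
     probability suffices. *)
  have [fe1|fe1] := ltP (err (f y z)) e1; first by apply: IH => //; exact: past_draw.
  apply: (@le_trans _ _ (1 * pr (H `&` [set w | Z N w = z]))).
    rewrite mul1r -lee_fin -!prE//; apply: le_measure; rewrite ?inE//.
  by rewrite ler_wpM2r ?pr_ge0// ler_pdivlMr// mul1r.
rewrite sumEFin lee_fin.
under eq_bigr do rewrite mulrAC.
rewrite -mulr_suml mulrAC ler_wpM2r ?invr_ge0 ?(ltW e1_gt0)//.
apply: (le_trans (contraction pH Hy ye1)).
by rewrite ler_wpM2r ?pr_ge0// ler_piMl.
Qed.

(** Here [rho] bounds the conditional probability of ever reaching the threshold. The conclusions
    stay unnormalized, as masses and integrals over the event, so that no division occurs before the
    final theorem. *)
Lemma local_contraction k x rho :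
  (0 < P [set w | X k w = x])%E -> err x <= e1 * rho -> rho < 1 ->
  exists A : set T,
    [/\ sigma_of Z [set j | (k <= j)%N] A,
        measurable (A `&` [set w | X k w = x]),
        (1 - rho) * pr [set w | X k w = x] <= pr (A `&` [set w | X k w = x]) &
        forall h, (\int[P]_(w in A `&` [set w | X k w = x])
                     (err (X (k + h)%N w))%:E
                   <= (C ^+ h * err x * pr [set w | X k w = x])%:E)%E].
Proof.
set B := [set w | X k w = x] => PB xe1 rho1.
have pB : past k B by exact: (past_state (fun y => y = x)).
have mB := past_measurable pB.
have ye1 : err x < e1 by apply: (le_lt_trans xe1); rewrite gtr_pMr.
(* A must depend on the draws after k only, so it is defined through the chain
   Y restarted at x rather than through X. *)
pose Y := fix Y h w := if h is h'.+1 then f (Y h' w) (Z (k + h')%N w) else x.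
have YX h w : B w -> X (k + h)%N w = Y h w.
  by move=> Bw; elim: h => [|h IH]; rewrite ?addn0// addnS XS IH.
pose A := \bigcap_h [set w | err (Y h w) < e1].
have AB : A `&` B = B `&` \bigcap_h stay k h.
  apply/seteqP; split => w [w1 w2]; split => //.
    by move=> h _ i ih; rewrite YX//; exact: w1.
  by move=> h _ /=; rewrite -YX//; exact: (w2 h).
have mS : measurable (\bigcap_h stay k h).
  by apply: bigcap_measurable => // h _; exact: measurable_stay.
have mAB : measurable (A `&` B) by rewrite AB; exact: measurableI.
exists A; split => //.
- apply: sigma_of_bigcap => h.
  apply: (@sigma_of_orbit _ _ _ Z _ f Y x k _ _ _ h (fun y => err y < e1)) => //.
  by move=> j /andP[].
- have exit_le : pr (B `\` (A `&` B)) <= rho * pr B.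
    rewrite AB -lee_fin -prE; last by apply: measurableD => //; exact: measurableI.
    have -> : B `\` (B `&` \bigcap_h stay k h) = \bigcup_h (B `\` stay k h).
      by rewrite setDIr setDv set0U setDE setC_bigcap setI_bigcupr.
    have mD h : measurable (B `\` stay k h).
      by apply: measurableD => //; exact: measurable_stay.
    have ndD : {homo (fun h => B `\` stay k h) : n m / (n <= m)%N >-> (n <= m)%O}.
      move=> h h' hh'; apply/subsetPset => w [Bw nw]; split => // sw; apply: nw.
      by move=> i ih; apply: sw; exact: leq_trans hh'.
    (* Continuity from below: the exit events up to time [h] increase to the event of leaving at
       some time, and the uniform bound passes to the limit. *)
    have cv := @nondecreasing_cvg_mu _ _ _ P _ mD (bigcup_measurable (fun h _ => mD h)) ndD.
    rewrite -(cvg_lim _ cv)//; apply: lime_le; first by apply/cvg_ex; eexists; exact: cv.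
    apply: nearW => h /=; rewrite prE// lee_fin.
    apply: (le_trans (prob_exit h pB _ ye1)) => //.
    by rewrite ler_wpM2r ?pr_ge0// ler_pdivrMr// mulrC.
  have : pr B = pr (A `&` B) + pr (B `\` (A `&` B)).
    apply: EFin_inj; rewrite EFinD -!prE//; last exact: measurableD.
    rewrite -measureU//; last 2 first.
    - exact: measurableD.
    - by apply/seteqP; split => // w [ABw [_ /(_ ABw)]].
    by congr (P _); rewrite setDUK.
  by move=> E; lra.
- move=> h; apply: le_trans (expect_stay h pB _ ye1) => //.
  apply: ge0_subset_integral => //.
  + by apply: measurableI => //; exact: measurable_stay.
  + exact: measurable_err.
  + by move=> w _; rewrite lee_fin.
  + by rewrite AB => w [Bw sw]; split => //; exact: sw.
Qed.

End Chain.

(** * One step of the algorithm near the solutions *)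

Section Euclid.
Variables (R : realType) (d : nat).
Implicit Types u v w : 'cV[R]_d.

Lemma enorm_sqr v : enorm v ^+ 2 = \sum_(i < d) v i 0 ^+ 2.
Proof. by rewrite /enorm sqr_sqrtr// sumr_ge0// => i _; exact: sqr_ge0. Qed.

Lemma enorm_sqr_gt0 v : v != 0 -> 0 < enorm v ^+ 2.
Proof.
move=> v0; rewrite lt_def sqr_ge0 andbT; apply: contra v0.
rewrite enorm_sqr psumr_eq0 => [/allP v0|i _]; last exact: sqr_ge0.
apply/eqP/matrixP => i j; rewrite ord1 mxE; apply/eqP.
by rewrite -sqrf_eq0; apply: v0; rewrite mem_index_enum.
Qed.

Lemma enorm_sqr_line v w (a : R) : enorm (v - a *: w) ^+ 2 =
  enorm v ^+ 2 - 2 * a * (w^T *m v) 0 0 + a ^+ 2 * enorm w ^+ 2.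
Proof.
rewrite !enorm_sqr mxE !mulr_sumr -sumrB -big_split/=.
by apply: eq_bigr => i _; rewrite !mxE; ring.
Qed.

Lemma cauchy_schwarz v w : (w^T *m v) 0 0 ^+ 2 <= enorm w ^+ 2 * enorm v ^+ 2.
Proof.
have [->|w0] := eqVneq w 0.
  by rewrite trmx0 mul0mx mxE expr0n/= mulr_ge0 ?sqr_ge0.
have A0 := enorm_sqr_gt0 w0; set A := enorm w ^+ 2 in A0 *.
(* The residual of [v] after projection onto the line of [w] has nonnegative squared norm;
   multiplying by [A] clears the denominator. *)
have := sqr_ge0 (enorm (v - ((w^T *m v) 0 0 / A) *: w)).
rewrite enorm_sqr_line -/A; set p := (_ *m _) 0 0; set B := enorm v ^+ 2 => h.
have : 0 <= A * (B - 2 * (p / A) * p + (p / A) ^+ 2 * A).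
  by rewrite mulr_ge0// ltW.
rewrite (_ : A * _ = A * B - p ^+ 2) ?subr_ge0//.
by field; rewrite gt_eqF.
Qed.

Lemma mulmx_row_le m (M : 'M[R]_(m, d)) v l :
  (M *m v) l 0 ^+ 2 <= enorm (row l M)^T ^+ 2 * enorm v ^+ 2.
Proof.
rewrite (_ : (M *m v) l 0 = ((row l M)^T^T *m v) 0 0); first exact: cauchy_schwarz.
by rewrite trmxK -row_mul [RHS]mxE.
Qed.

End Euclid.

(** An injective matrix has a left inverse, here [B^T]. Cauchy-Schwarz on each of its rows gives its
    squared Frobenius norm as [K]. *)
Lemma injective_mulmx_bound (R : realType) (m d : nat) (N : 'M[R]_(m, d)) :
  (forall v : 'cV[R]_d, N *m v = 0 -> v = 0) ->
  exists2 K : R, 0 <= K & forall v, enorm v ^+ 2 <= K * enorm (N *m v) ^+ 2.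
Proof.
move=> Ninj.
have /row_freeP[B NB] : row_free N^T.
  rewrite -kermx_eq0; apply/eqP/row_matrixP => i; rewrite row0.
  apply: trmx_inj; rewrite trmx0; apply: Ninj.
  apply: trmx_inj; rewrite trmx_mul trmxK trmx0 -row_mul mulmx_ker.
  exact: row0.
exists (\sum_i enorm (row i B^T)^T ^+ 2).
  by apply: sumr_ge0 => i _; exact: sqr_ge0.
move=> v; have vE : v = B^T *m (N *m v).
  by rewrite mulmxA -(trmxK N) -trmx_mul NB trmx1 mul1mx.
rewrite {1}vE enorm_sqr mulr_suml; apply: ler_sum => i _.
exact: mulmx_row_le.
Qed.

(** The inverse of the witness dominates each [(f i)^-1]. Since [0^-1 = 0], vanishing values add
    nothing, and the summand 1 keeps that inverse positive when all values vanish. *)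
Lemma nonzero_values_gap (R : realType) (I : finType) (f : I -> R) :
  (forall i, 0 <= f i) -> exists2 e : R, 0 < e & forall i, f i != 0 -> e <= f i.
Proof.
move=> f0; have S0 : 0 < 1 + \sum_i (f i)^-1.
  by rewrite ltr_wpDr ?ltr01// sumr_ge0// => i _; rewrite invr_ge0.
exists (1 + \sum_i (f i)^-1)^-1; first by rewrite invr_gt0.
move=> i fi; have fi0 : 0 < f i by rewrite lt_def fi f0.
rewrite -[leRHS]invrK lef_pV2 ?posrE ?invr_gt0// (bigD1 i)//= addrCA lerDl.
by rewrite addr_ge0// sumr_ge0// => j _; rewrite invr_ge0.
Qed.

(** * Decrease and growth of the error in one update *)

Section LocalStep.
Variables (R : realType) (m d n : nat).
Variables (M : 'M[R]_(m, d)) (b : 'cV[R]_m) (xs : 'I_n.+1 -> 'cV[R]_d).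
Hypothesis hrow : forall l, row l M != 0.
Hypothesis solvable : forall l, exists i, (M *m xs i) l 0 = b l 0.
Implicit Types (y : 'I_n.+1 -> 'cV[R]_d) (l : 'I_m) (i j s t : 'I_n.+1).

Let A l : R := enorm (row l M)^T ^+ 2.

(** Only these rows constrain the [j]-th solution when the others are fixed: any other row is solved
    by some index different from [j]. *)
Definition exclusive l j : bool :=
  [forall i, ((M *m xs i) l 0 == b l 0) == (i == j)].

Lemma row_norm_gt0 l : 0 < A l.
Proof. by apply: enorm_sqr_gt0; rewrite -trmx0 (inj_eq trmx_inj). Qed.

Lemma sq_error_ge0 y : 0 <= sq_error xs y.
Proof. by apply: sumr_ge0 => i _; exact: sqr_ge0. Qed.

Lemma le_sq_error y i : enorm (y i - xs i) ^+ 2 <= sq_error xs y.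
Proof.
rewrite /sq_error (bigD1 i)//= lerDl sumr_ge0// => j _; exact: sqr_ge0.
Qed.

Lemma mrk_coef_shift y l i :
  mrk_coef M b y l i = mrk_coef M b xs l i + (M *m (y i - xs i)) l 0 / A l.
Proof. by rewrite /mrk_coef mulmxBr !mxE -mulrDl; congr (_ / _); ring. Qed.

Lemma shift_le y l i :
  ((M *m (y i - xs i)) l 0 / A l) ^+ 2 * A l <= enorm (y i - xs i) ^+ 2.
Proof.
have A0 := row_norm_gt0 l; have := mulmx_row_le M (y i - xs i) l.
rewrite -/(A l) => h; rewrite expr_div_n (_ : _ / _ * _ = ((M *m (y i - xs i)) l 0) ^+ 2 / A l).
  by rewrite ler_pdivrMr// mulrC.
by field; rewrite gt_eqF.
Qed.

Lemma mrk_coef_solved y l s : (M *m xs s) l 0 = b l 0 ->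
  mrk_coef M b y l s = (M *m (y s - xs s)) l 0 / A l.
Proof. by move=> h; rewrite mrk_coef_shift /mrk_coef h subrr mul0r add0r. Qed.

Lemma sq_error_step y l s t :
  sq_error xs (mrk_step M b y l s t) =
  sq_error xs y
  - 2 * (`|mrk_coef M b y l s| * Num.sg (mrk_coef M b y l t))
      * (M *m (y t - xs t)) l 0
  + (`|mrk_coef M b y l s| * Num.sg (mrk_coef M b y l t)) ^+ 2 * A l.
Proof.
set a := _ * Num.sg _; rewrite /sq_error (bigD1 t)//= [in RHS](bigD1 t)//=.
rewrite {1}/mrk_step eqxx -/a addrAC enorm_sqr_line trmxK.
rewrite -row_mul [row _ _ _ _]mxE -/(A l).
rewrite (eq_bigr (fun i => enorm (y i - xs i) ^+ 2)); last first.
  by move=> i it; rewrite /mrk_step (negbTE it).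
ring.
Qed.

(** Since [|c| sgn c = c], the step is the orthogonal projection onto the hyperplane of row [l],
    which contains [xs s]; this is Pythagoras. *)
Lemma sq_error_step_argmin y l s : (M *m xs s) l 0 = b l 0 ->
  sq_error xs (mrk_step M b y l s s) =
  sq_error xs y - mrk_coef M b y l s ^+ 2 * A l.
Proof.
move=> hs; rewrite sq_error_step mulrC [_ * Num.sg _]mulrC -numEsg.
rewrite {1}[mrk_coef _ _ _ _ _]mrk_coef_solved// [in RHS]mrk_coef_solved//.
rewrite mrk_coef_solved//.
by field; rewrite gt_eqF// row_norm_gt0.
Qed.

(** Whichever index [t] moves, the step is no longer than the distance from [y s] to [xs s]. *)
Lemma sq_error_step_le y l s t : (M *m xs s) l 0 = b l 0 ->
  sq_error xs (mrk_step M b y l s t) <= 4 * sq_error xs y.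
Proof.
move=> hs; rewrite sq_error_step; set a := _ * Num.sg _.
have aA : a ^+ 2 * A l <= sq_error xs y.
  apply: (le_trans _ (le_sq_error y s)); apply: (le_trans _ (shift_le y l s)).
  rewrite ler_wpM2r ?sqr_ge0// -mrk_coef_solved// /a exprMn real_normK ?num_real//.
  by rewrite ler_piMr ?sqr_ge0// sqr_sg; case: (_ != 0).
(* Reversing the sign of [a] in the squared norm bounds the cross term by the two squares; four
   terms then remain, each at most the error. *)
have := le_sq_error y t; have := sqr_ge0 (enorm (y t - xs t + a *: (row l M)^T)).
rewrite -[a]opprK scaleNr enorm_sqr_line opprK trmxK -row_mul [row _ _ _ _]mxE.
rewrite sqrrN -/(A l) mulrN mulNr opprK => h1 h2.
lra.
Qed.

(** Some [i] solves the row, so its residual is a pure perturbation, and the argmin residual is no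
    larger. If [s] did not solve the row, its residual at [xs] would then be too small for the
    gap. *)
Lemma argmin_solves y l s :
  (forall i, (M *m xs i) l 0 != b l 0 ->
     4 * sq_error xs y < mrk_coef M b xs l i ^+ 2 * A l) ->
  is_argmin M b y l s -> (M *m xs s) l 0 = b l 0.
Proof.
move=> gap smin; apply/eqP; apply: contraT => hs; have [i hi] := solvable l.
have := gap _ hs; rewrite ltNge => /negP; case.
have : mrk_coef M b y l s ^+ 2 <= mrk_coef M b y l i ^+ 2.
  by rewrite -[leLHS]real_normK ?num_real// -[leRHS]real_normK ?num_real// ler_sqr ?nnegrE.
rewrite [mrk_coef M b y l i]mrk_coef_solved// mrk_coef_shift.
have := shift_le y l s; have := shift_le y l i.
have := le_sq_error y s; have := le_sq_error y i.
set p := _ / A l; set q := _ / A l; set c := mrk_coef _ _ _ _ _.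
move=> hi' hs' hp hq hc.
have : c ^+ 2 * A l <= (2 * p ^+ 2 + 2 * q ^+ 2) * A l.
  rewrite ler_wpM2r ?(ltW (row_norm_gt0 l))//.
  (* The identity [c^2 = 2(c+q)^2 + 2q^2 - (c+2q)^2], combined with [hc]. *)
  have := sqr_ge0 (c + 2 * q); nra.
lra.
Qed.


Lemma exclusive_rows_span j (v : 'cV[R]_d) : unique_solutions M b xs ->
  (forall l, exclusive l j -> (M *m v) l 0 = 0) -> v = 0.
Proof.
move=> huniq hv.
(* Moving the j-th solution by v keeps every row solved, so the new points are
   a relabeling of the old ones; comparing the sums gives v = 0. *)
pose y i := if i == j then xs j + v else xs i.
have [|sg hsg] := huniq y.
  move=> l; have [i hi] := solvable l.
  have [lj|] := boolP (exclusive l j).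
    exists j; rewrite /y eqxx mulmxDr mxE hv// addr0.
    by have /forallP/(_ j) := lj; rewrite eqxx eqb_id => /eqP.
  have [ij|ij _] := eqVneq i j; last by exists i; rewrite /y (negbTE ij).
  move=> /forallPn[i']; have [->|i'j] := eqVneq i' j; first by rewrite -ij hi eqxx.
  rewrite eqbF_neg negbK => /eqP hi'; exists i'.
  by rewrite /y (negbTE i'j).
have : \sum_i y i = \sum_i xs i.
  by rewrite (reindex_inj (@perm_inj _ sg)); apply: eq_bigr => i _; rewrite hsg.
rewrite (bigD1 j)//= /y eqxx (bigD1 j (F := xs))//=.
rewrite (eq_bigr xs) => [|i ij]; last by rewrite (negbTE ij).
by move/addIr => h; apply: (addrI (xs j)); rewrite addr0.
Qed.

(* A lower bound for the decrease of the error when row l is drawn and the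
   argmin iterate is updated; at most one term of the sum is nonzero. *)
Definition gain y l : R :=
  \sum_j (exclusive l j)%:R * ((M *m (y j - xs j)) l 0 ^+ 2 / A l).

Lemma gain_le_argmin y l s : (M *m xs s) l 0 = b l 0 ->
  gain y l <= mrk_coef M b y l s ^+ 2 * A l.
Proof.
move=> hs; rewrite /gain (bigD1 s)//= big1 ?addr0 => [|j js].
  rewrite mrk_coef_solved// (_ : _ / _ = ((M *m (y s - xs s)) l 0 / A l) ^+ 2 * A l).
    rewrite ler_piMl ?lern1 ?leq_b1//.
    by rewrite mulr_ge0 ?sqr_ge0// ltW// row_norm_gt0.
  by field; rewrite gt_eqF// row_norm_gt0.
have [/forallP/(_ s)|] := boolP (exclusive l j); last by rewrite mul0r.
by rewrite hs eqxx [s == j]eq_sym (negbTE js).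
Qed.

(** For each [j] the exclusive rows determine a vector, and injectivity in finite dimension is
    quantitative. The constants of all [j] are then merged into one, the summand 1 ensuring
    [a <= 1]. *)
Lemma gain_coercive (D : 'I_m -> R) : unique_solutions M b xs ->
  (forall l, 0 < D l) ->
  exists2 a : R, 0 < a <= 1 & forall y, a * sq_error xs y <= \sum_l D l * gain y l.
Proof.
move=> huniq D0.
have ADge0 l : 0 <= A l / D l by rewrite divr_ge0// ltW// row_norm_gt0.
have coord j : exists c : R, 0 <= c /\ forall v : 'cV[R]_d, enorm v ^+ 2 <=
    c * \sum_l D l * ((exclusive l j)%:R * ((M *m v) l 0 ^+ 2 / A l)).
  (* [N] keeps the rows exclusive to [j] and replaces the others by zero rows. *)
  pose N := \matrix_(l, i) ((exclusive l j)%:R * M l i).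
  have NE (v : 'cV[R]_d) l : (N *m v) l 0 = (exclusive l j)%:R * (M *m v) l 0.
    by rewrite !mxE mulr_sumr; apply: eq_bigr => i _; rewrite mxE mulrA.
  have [v Nv|K K0 HK] := @injective_mulmx_bound _ _ _ N.
    apply: (exclusive_rows_span (j := j)) => // l lj.
    by have := NE v l; rewrite Nv mxE lj mul1r.
  (* Each squared entry of [N *m v] is its weighted term in the gain times [A l / D l]. *)
  exists (K * \sum_l A l / D l); split; first by rewrite mulr_ge0// sumr_ge0.
  move=> v; apply: (le_trans (HK v)); rewrite -mulrA ler_wpM2l//.
  rewrite enorm_sqr mulr_sumr; apply: ler_sum => l _; rewrite NE.
  have -> : ((exclusive l j)%:R * (M *m v) l 0) ^+ 2 =
     A l / D l * (D l * ((exclusive l j)%:R * ((M *m v) l 0 ^+ 2 / A l))).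
    rewrite exprMn (_ : (_%:R : R) ^+ 2 = (exclusive l j)%:R).
      by field; rewrite !gt_eqF// row_norm_gt0.
    by case: exclusive; rewrite ?expr1n// expr0n.
  rewrite ler_wpM2r//.
    by rewrite mulr_ge0 ?(ltW (D0 _))// mulr_ge0 ?ler0n// divr_ge0 ?sqr_ge0// ltW// row_norm_gt0.
  by rewrite (bigD1 l)//= lerDl sumr_ge0.
have [c hc] := choice coord.
have c0 j : 0 <= c j by have [] := hc j.
have S1 : 1 <= 1 + \sum_j c j by rewrite lerDl sumr_ge0.
have S0 : 0 < 1 + \sum_j c j by exact: lt_le_trans S1.
exists (1 + \sum_j c j)^-1; first by rewrite invr_gt0 S0 invf_le1.
move=> y; rewrite /gain mulr_sumr.
under [leRHS]eq_bigr do rewrite mulr_sumr.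
rewrite exchange_big/=; apply: ler_sum => j _.
set Q := leRHS.
have Q0 : 0 <= Q.
  apply: sumr_ge0 => l _.
  by rewrite mulr_ge0 ?(ltW (D0 _))// mulr_ge0 ?ler0n// divr_ge0 ?sqr_ge0// ltW// row_norm_gt0.
rewrite mulrC ler_pdivrMr//; apply: (le_trans ((hc j).2 _)).
rewrite mulrC ler_wpM2l// (bigD1 j)//= addrCA lerDl.
by rewrite addr_ge0// sumr_ge0.
Qed.

(** The argmin index is part of the draw because ties are broken by an arbitrary rule; the update is
    thus a deterministic function of state and draw. *)
Definition mrk_draw_step y (z : 'I_m * 'I_n.+1 * bool * 'I_n.+1) :=
  let: (l, s, w, u) := z in mrk_step M b y l s (if w then u else s).

(** The regular branch has mass [1 - r] and the exact projection decrease; the swap branch has mass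
    [r] and the crude factor 4. *)
Lemma swap_average y l s (r : R) : 0 <= r <= 1 -> (M *m xs s) l 0 = b l 0 ->
  \sum_w \sum_u (if w then r else 1 - r) / n.+1%:R *
     sq_error xs (mrk_draw_step y (l, s, w, u))
  <= (1 - r) * (sq_error xs y - gain y l) + 4 * r * sq_error xs y.
Proof.
move=> /andP[r0 r1] hs; rewrite big_bool/= addrC.
have n0 : (n.+1%:R : R) != 0 by rewrite pnatr_eq0.
apply: lerD.
  rewrite sumr_const card_ord -[leLHS]mulr_natr mulrAC (divfK n0) ler_wpM2l ?subr_ge0//.
  by rewrite sq_error_step_argmin// lerD2l lerN2 gain_le_argmin.
apply: (@le_trans _ _ (\sum_(u < n.+1) r / n.+1%:R * (4 * sq_error xs y))).
  apply: ler_sum => u _; rewrite ler_wpM2l ?divr_ge0//.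
  exact: sq_error_step_le.
by rewrite sumr_const card_ord -[leLHS]mulr_natr le_eqVlt; apply/orP; left; apply/eqP; field.
Qed.

End LocalStep.

(** * Expected error after one random step *)

(** The index is that of the block from which the shuffled row comes. *)
Lemma stacked_solvable (R : realType) (n d : nat) (p : 'I_n.+1 -> nat)
    (Ms : forall i : 'I_n.+1, 'M[R]_(p i, d))
    (bs : forall i : 'I_n.+1, 'cV[R]_(p i)) (xs : 'I_n.+1 -> 'cV[R]_d)
    (shuffle : 'S_(\sum_(i < n.+1) p i)%N) l :
  (forall i, Ms i *m xs i = bs i) ->
  exists i, (row_perm shuffle (\mxcol_(i < n.+1) Ms i) *m xs i) l 0 =
            row_perm shuffle (\mxcol_(i < n.+1) bs i) l 0.
Proof.
move=> hsol; exists (tagnat.sig1 (shuffle l)).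
rewrite row_permE -mulmxA mxcol_mul -row_permE.
by rewrite [LHS]mxE [RHS]mxE [LHS]mxE [RHS]mxE hsol.
Qed.

Section MrkDrift.
Context (disp : measure_display) (T : measurableType disp) (R : realType).
Variables (P : probability T R) (m d n : nat).
Variables (M : 'M[R]_(m, d)) (b : 'cV[R]_m) (xs : 'I_n.+1 -> 'cV[R]_d).
Variables (D : 'I_m -> R) (r : R) (x0 : 'I_n.+1 -> 'cV[R]_d).
Variables (I : nat -> T -> 'I_m) (S : nat -> T -> 'I_n.+1).
Variables (W : nat -> T -> bool) (U : nat -> T -> 'I_n.+1).
Variable X : nat -> T -> 'I_n.+1 -> 'cV[R]_d.
Hypothesis run : mrk_run P M b D r x0 I S W U X.
Hypothesis hD : is_distribution D.
Hypothesis r01 : 0 <= r <= 1.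
Hypothesis hrow : forall l, row l M != 0.
Hypothesis solvable : forall l, exists i, (M *m xs i) l 0 = b l 0.

(** An atom of the draw factors into the mass [q l s] and the law of coin and uniform index.
    Averaging over the latter is [swap_average]; summing [q l s] over [s] restores the row law,
    whatever the tie-breaking. *)
Lemma mrk_drift N y H (a : R) :
  sigma_of (mrk_draws I S W U) [set j | (j < N)%N] H ->
  H `<=` [set w | X N w = y] ->
  (forall l i, (M *m xs i) l 0 != b l 0 ->
     4 * sq_error xs y < mrk_coef M b xs l i ^+ 2 * enorm (row l M)^T ^+ 2) ->
  a * sq_error xs y <= \sum_l D l * gain M b xs y l ->
  \sum_z sq_error xs (mrk_draw_step M b y z) *
     fine (P (H `&` [set w | mrk_draws I S W U N w = z]))
  <= (1 - (1 - r) * a + 4 * r) * sq_error xs y * fine (P H).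
Proof.
move=> sH Hy gap coer.
have mZ := mrk_measurable run.
have mH : measurable H by exact: sigma_of_measurable sH.
have mE (Q : set ('I_m * 'I_n.+1 * bool * 'I_n.+1)) :
    measurable [set w | Q (mrk_draws I S W U N w)].
  exact: (sigma_of_measurable mZ (@sigma_of_draw _ _ _ _ [set N] N Q erefl)).
pose q l s := fine (P (H `&` [set w | I N w = l /\ S N w = s])).
have mq l s : measurable (H `&` [set w | I N w = l /\ S N w = s]).
  apply: measurableI => //.
  exact: (mE (fun z => z.1.1.1 = l /\ z.1.1.2 = s)).
have atomE l s v u : fine (P (H `&` [set w | mrk_draws I S W U N w = (l, s, v, u)]))
    = q l s * ((if v then r else 1 - r) / n.+1%:R).
  have -> : H `&` [set w | mrk_draws I S W U N w = (l, s, v, u)] =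
      H `&` [set w | I N w = l /\ S N w = s] `&` [set w | W N w = v /\ U N w = u].
    rewrite /mrk_draws; apply/seteqP; split => w /=; first by move=> [Hw [<- <- <- <-]].
    by move=> [[Hw [<- <-]] [<- <-]].
  by rewrite (mrk_swap_law run)// fineM ?fin_num_measure.
have q_sum l : \sum_s q l s = fine (P H) * D l.
  have mI : measurable [set w | I N w = l] by exact: (mE (fun z => z.1.1.1 = l)).
  have := mrk_row_law run l sH.
  rewrite (@probability_partition _ _ _ P _ (S N)); last 2 first.
  - by move=> s; exact: (mE (fun z => z.1.1.2 = s)).
  - exact: measurableI.
  move=> /(congr1 fine); rewrite fineM ?fin_num_measure//= => <-.
  rewrite -sum_fine => [|s _].
    apply: eq_bigr => s _; congr (fine (P _)).
    by apply/seteqP; split => w /=; tauto.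
  rewrite fin_num_measure//; apply: measurableI; first exact: measurableI.
  exact: (mE (fun z => z.1.1.2 = s)).
rewrite (eq_bigr (fun z => sq_error xs (mrk_draw_step M b y (z.1.1.1, z.1.1.2, z.1.2, z.2))
    * (q z.1.1.1 z.1.1.2 * ((if z.1.2 then r else 1 - r) / n.+1%:R)))); last first.
  by move=> [[[l s] v] u] _; rewrite atomE.
rewrite -(pair_bigA _ (fun t u => sq_error xs (mrk_draw_step M b y (t.1.1, t.1.2, t.2, u))
    * (q t.1.1 t.1.2 * ((if t.2 then r else 1 - r) / n.+1%:R))))/=.
rewrite -(pair_bigA _ (fun t v => \sum_u sq_error xs (mrk_draw_step M b y (t.1, t.2, v, u))
    * (q t.1 t.2 * ((if v then r else 1 - r) / n.+1%:R))))/=.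
rewrite -(pair_bigA _ (fun l s => \sum_v \sum_u sq_error xs (mrk_draw_step M b y (l, s, v, u))
    * (q l s * ((if v then r else 1 - r) / n.+1%:R))))/=.
pose B l := (1 - r) * (sq_error xs y - gain M b xs y l) + 4 * r * sq_error xs y.
apply: (@le_trans _ _ (\sum_l \sum_s q l s * B l)).
  apply: ler_sum => l _; apply: ler_sum => s _.
  rewrite (_ : \sum_v _ = q l s * \sum_v \sum_u (if v then r else 1 - r) / n.+1%:R *
      sq_error xs (mrk_draw_step M b y (l, s, v, u))); last first.
    rewrite mulr_sumr; apply: eq_bigr => v _; rewrite mulr_sumr.
    by apply: eq_bigr => u _; ring.
  (* The argmin property is pathwise, so a sample point is needed to know that [s] is an argmin at
     [y]; an empty event has mass zero. *)
  have [H0|/set0P[w [Hw /= [Iw Sw]]]] :=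
      eqVneq (H `&` [set w | I N w = l /\ S N w = s]) set0.
    by rewrite /q H0 measure0 !mul0r.
  rewrite ler_wpM2l ?fine_ge0//; apply: swap_average => //.
  apply: (argmin_solves hrow solvable (gap l)).
  by have := mrk_argmin run N w; rewrite (Hy _ Hw) Iw Sw.
under eq_bigr do rewrite -mulr_suml q_sum.
have -> : \sum_l fine (P H) * D l * B l = fine (P H) * (sq_error xs y
    - (1 - r) * (\sum_l D l * gain M b xs y l) - r * sq_error xs y + 4 * r * sq_error xs y).
  transitivity (fine (P H) * \sum_l (D l * ((1 - r) * sq_error xs y + 4 * r * sq_error xs y)
     - (1 - r) * (D l * gain M b xs y l))).
    by rewrite mulr_sumr; apply: eq_bigr => l _; rewrite /B; ring.
  by rewrite sumrB -mulr_suml hD.2 -mulr_sumr; congr (_ * _); ring.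
rewrite [leRHS]mulrC ler_wpM2l ?fine_ge0//.
move: r01 => /andP[r0 r1]; have e0 := sq_error_ge0 xs y.
set g := \sum_l _ in coer *.
have : (1 - r) * (a * sq_error xs y) <= (1 - r) * g by rewrite ler_wpM2l ?subr_ge0.
have : 0 <= r * sq_error xs y by rewrite mulr_ge0.
lra.
Qed.

End MrkDrift.

(** * Choice of the constants and conclusion *)

Theorem theorem1 (R : realType) (n d : nat) (hd : (1 <= d)%N)
    (p : 'I_n.+1 -> nat)
    (Ms : forall i : 'I_n.+1, 'M[R]_(p i, d))
    (bs : forall i : 'I_n.+1, 'cV[R]_(p i))
    (xs : 'I_n.+1 -> 'cV[R]_d)
    (hsol : forall i, Ms i *m xs i = bs i)
    (shuffle : 'S_(\sum_(i < n.+1) p i)%N)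
    (M : 'M[R]_((\sum_(i < n.+1) p i)%N, d))
    (b : 'cV[R]_(\sum_(i < n.+1) p i)%N)
    (hM : M = row_perm shuffle (\mxcol_(i < n.+1) Ms i))
    (hb : b = row_perm shuffle (\mxcol_(i < n.+1) bs i))
    (hrow : forall l, row l M != 0)
    (huniq : unique_solutions M b xs)
    (D : 'I_(\sum_(i < n.+1) p i)%N -> R)
    (hD : is_distribution D)
    (hDpos : forall l, 0 < D l) :
  exists r0 : R, 0 < r0 /\
  forall r : R, 0 <= r <= r0 ->
  exists C0 : R, C0 < 1 /\
  forall c : R, C0 < c < 1 ->
  forall delta : R, 0 < delta ->
  exists eps : R, 0 < eps /\
  forall (disp : measure_display) (T : measurableType disp)
    (P : probability T R) (x0 : 'I_n.+1 -> 'cV[R]_d)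
    (I : nat -> T -> 'I_(\sum_(i < n.+1) p i)%N)
    (S : nat -> T -> 'I_n.+1) (W : nat -> T -> bool) (U : nat -> T -> 'I_n.+1)
    (X : nat -> T -> 'I_n.+1 -> 'cV[R]_d),
  mrk_run P M b D r x0 I S W U X ->
  forall (k : nat) (x : 'I_n.+1 -> 'cV[R]_d),
  (0 < P [set w | X k w = x])%E ->
  sq_error xs x < eps ->
  exists A : set T,
    [/\ sigma_of (mrk_draws I S W U) [set j | (k <= j)%N] A,
        ((1 - delta)%:E <= cond_prob P A [set w | X k w = x])%E,
        (0 < P (A `&` [set w | X k w = x]))%E &
        forall h : nat,
          (cond_expect P (fun w => sq_error xs (X (k + h)%N w))
             (A `&` [set w | X k w = x])
           <= (c ^+ h * sq_error xs x)%:E)%E].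
Proof.
have solvable l : exists i, (M *m xs i) l 0 = b l 0.
  by rewrite hM hb; exact: stacked_solvable.
have [a /andP[a0 a1] coer] := gain_coercive hrow solvable huniq hDpos.
(* [f] is the squared distance from the [i]-th solution to the hyperplane of row [l]; a quarter of a
   lower bound on its nonzero values gives the threshold [e1]. *)
pose f (li : 'I_(\sum_(i < n.+1) p i)%N * 'I_n.+1) :=
  mrk_coef M b xs li.1 li.2 ^+ 2 * enorm (row li.1 M)^T ^+ 2.
have [|e0 e0_gt0 he0] := @nonzero_values_gap _ _ f.
  by move=> li; rewrite mulr_ge0 ?sqr_ge0.
pose e1 := e0 / 4; have e1_gt0 : 0 < e1 by rewrite divr_gt0.
have gap y : sq_error xs y < e1 -> forall l i, (M *m xs i) l 0 != b l 0 ->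
    4 * sq_error xs y < mrk_coef M b xs l i ^+ 2 * enorm (row l M)^T ^+ 2.
  move=> ye1 l i hli; have Al := row_norm_gt0 hrow l.
  apply: (@lt_le_trans _ _ e0); first by move: ye1; rewrite /e1; lra.
  apply: (he0 (l, i)); rewrite /f/= mulf_neq0 ?(gt_eqF Al)// sqrf_eq0.
  by rewrite /mrk_coef mulf_neq0 ?invr_eq0 ?(gt_eqF Al)// subr_eq0.
(* This choice makes [r (a + 4) <= a / 2], so the drift factor [1 - (1 - r) a + 4 r] is at most
   [1 - a / 2]. *)
exists (a / (2 * (a + 4))); split; first by rewrite divr_gt0// mulr_gt0//; lra.
move=> r /andP[r_ge0]; rewrite ler_pdivlMr; last by lra.
move=> ra; have r_le1 : r <= 1 by nra.
pose C0 := 1 - a / 2; exists C0; split; first by rewrite /C0; lra.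
move=> c /andP[C0c c1] delta delta0.
have C0_gt0 : 0 < C0 by rewrite /C0; lra.
have c0 : 0 < c by exact: lt_trans C0c.
(* The first bound controls the probability of [A]; the second gives [C0 <= c (1 - rho)], so one
   factor [c / C0] pays for the conditioning. *)
pose rho := Num.min delta (1 - C0 / c).
have rho0 : 0 < rho by rewrite lt_min delta0 subr_gt0 ltr_pdivrMr// mul1r.
have rho_delta : rho <= delta by rewrite ge_min lexx.
have rho_c : rho <= 1 - C0 / c by rewrite ge_min lexx orbT.
have rho1 : rho < 1.
  by apply: (le_lt_trans rho_c); rewrite gtrDl oppr_lt0 divr_gt0.
have C0_le : C0 <= c * (1 - rho).
  by rewrite mulrC -ler_pdivrMr//; lra.
exists (e1 * rho); split; first by rewrite mulr_gt0.
move=> disp T P x0 I S W U X run k x; set B := [set w | X k w = x] => PB xe.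
have xe1 : sq_error xs x < e1 by apply: (lt_trans xe); rewrite gtr_pMr.
have mZ := mrk_measurable run.
have XS j w : X j.+1 w = mrk_draw_step M b (X j w) (mrk_draws I S W U j w).
  by rewrite (mrk_update run).
have drift N y H : sigma_of (mrk_draws I S W U) [set j | (j < N)%N] H ->
    H `<=` [set w | X N w = y] -> sq_error xs y < e1 ->
    \sum_z sq_error xs (mrk_draw_step M b y z) *
      fine (P (H `&` [set w | mrk_draws I S W U N w = z]))
    <= C0 * sq_error xs y * fine (P H).
  move=> sH Hy ye1; have r01 : 0 <= r <= 1 by rewrite r_ge0.
  apply: le_trans (mrk_drift run hD r01 hrow solvable sH Hy (gap y ye1) (coer y)) _.
  rewrite ler_wpM2r ?fine_ge0// ler_wpM2r ?sq_error_ge0// /C0; nra.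
have C0_le1 : C0 <= 1 by rewrite /C0; lra.
have [A [sA mAB PAB intA]] := local_contraction mZ (mrk_init run) XS
  (sq_error_ge0 xs) (ltW C0_gt0) C0_le1 e1_gt0 drift PB (ltW xe) rho1.
rewrite -/B in mAB PAB intA.
have mB : measurable B.
  exact: (measurable_state mZ (mrk_init run) XS k (fun y => y = x)).
have PBE : P B = (fine (P B))%:E by rewrite fineK// fin_num_measure.
have PABE : P (A `&` B) = (fine (P (A `&` B)))%:E.
  by rewrite fineK// fin_num_measure.
set pB := fine (P B) in PBE PAB intA.
set pAB := fine (P (A `&` B)) in PABE PAB.
have pB0 : 0 < pB by rewrite -lte_fin -PBE.
have pAB0 : 0 < pAB by apply: lt_le_trans PAB; rewrite mulr_gt0// subr_gt0.
exists A; split => //.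
- rewrite /cond_prob PABE PBE inver gt_eqF// -EFinM lee_fin ler_pdivlMr//.
  by apply: le_trans PAB; rewrite ler_wpM2r ?(ltW pB0)// lerD2l lerN2.
- by rewrite PABE lte_fin.
move=> h; rewrite /cond_expect PABE inver gt_eqF// lee_pdivrMr// -EFinM.
(* No factor [c] is available at [h = 0], where the error is constant on the event and the bound is
   an equality. *)
case: h => [|h].
  rewrite addn0 expr0 mul1r EFinM -PABE -integral_cst//.
  rewrite le_eqVlt; apply/orP; left; apply/eqP; apply: eq_integral => w.
  by rewrite inE => -[_ /= ->].
apply: (le_trans (intA h.+1)); rewrite lee_fin -!mulrA mulrCA [leRHS]mulrCA.
rewrite ler_wpM2l ?sq_error_ge0//.
apply: (@le_trans _ _ (c ^+ h.+1 * ((1 - rho) * pB))); last first.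
  by rewrite ler_wpM2l ?exprn_ge0 ?(ltW c0).
rewrite mulrA ler_wpM2r ?(ltW pB0)//.
(* One factor [C0] is bounded by [c (1 - rho)] and the other [h] factors by [c]. *)
rewrite !exprSr -mulrA ler_pM ?exprn_ge0 ?(ltW C0_gt0)//.
by rewrite lerXn2r ?nnegrE ?(ltW C0_gt0) ?(ltW c0) ?(ltW C0c).
Qed.
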